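(* Let $Y=(y_1,\dots,y_N)$ be a tuple of $N\in\mathbb{N}$ distinct points in $\mathbb{R}^3$. Let $S\subset\overline{\mathbb{C}}^N$ be closed in the compact metric space $\overline{\mathbb{C}}^N$, where $\overline{\mathbb{C}}=\mathbb{C}\cup\{\infty\}$ is the Riemann sphere, and let $\mathbb{F}=\{H_\alpha:\alpha\in S\}$. Then $\Sigma[\mathbb{F}]$ is a closed subset of $\mathbb{C}$ and, for every frequency $f$ achievable over $\mathbb{F}$, there exists an operator $H_\alpha\in\mathbb{F}$ of minimal decay for $f$.
   Context: Notation: $\mathbb{C}_-=\{z\in\mathbb{C}:\mathrm{Im}\,z<0\}$. $\overline{\mathbb{C}}$ carries the metric generated by stereographic projection onto the unit sphere $\mathbb{S}_2\subset\mathbb{R}^3$, and $\overline{\mathbb{C}}^N$ the corresponding product metric (the $\ell^2$-distance on $\mathbb{S}_2^N\subset\mathbb{R}^{3N}$). For $x\in\mathbb{R}^3\setminus\{0\}$ and $z\in\mathbb{C}$ put $G_z(x)=\frac{e^{\mathrm{i}z|x|}}{4\pi|x|}$. For $\alpha\in\mathbb{C}^N$, $\Gamma_{\alpha,Y}(z)$ is the $N\times N$ matrix with diagonal entries $\alpha_j-\frac{\mathrm{i}z}{4\pi}$ and off-diagonal entries $-G_z(y_j-y_{j'})$, $j\ne j'$. For $\alpha\in\overline{\mathbb{C}}^N$ one sets $\det\Gamma_{\alpha,Y}(z):=\det\Gamma_{\widetilde\alpha,\widetilde Y}(z)$, where $\widetilde\alpha,\widetilde Y$ are obtained from $\alpha,Y$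 by deleting the components with indices $j$ such that $\alpha_j=\infty$ (the determinant of the empty matrix is $1$). $\Sigma(\alpha,Y)\subset\mathbb{C}$ denotes the set of zeros of $\det\Gamma_{\alpha,Y}(\cdot)$, and $\Sigma_{\mathrm{res}}(\alpha,Y):=\Sigma(\alpha,Y)\cap(\mathbb{C}_-\cup\mathbb{R})$ is the set of resonances of the point-interaction Hamiltonian $H_\alpha=-\Delta_{\alpha,Y}$. $\Sigma[\mathbb{F}]=\bigcup_{\alpha\in S}\Sigma(\alpha,Y)$ and $\Sigma_{\mathrm{res}}[\mathbb{F}]=\bigcup_{\alpha\in S}\Sigma_{\mathrm{res}}(\alpha,Y)$. A real $f$ is an achievable frequency over $\mathbb{F}$ if $f=\mathrm{Re}\,k$ for some $k\in\Sigma_{\mathrm{res}}[\mathbb{F}]$; then $\mathfrak{r}_{\min}(f;\mathbb{F}):=\inf\{\mathfrak{r}\in[0,+\infty): f-\mathrm{i}\mathfrak{r}\in\Sigma_{\mathrm{res}}[\mathbb{F}]\}$. The operator $H_\alpha$ (with $\alpha\in S$) is of minimal decay for $f$ if $f-\mathrm{i}\,\mathfrak{r}_{\min}(f;\mathbb{F})\in\Sigma_{\mathrm{res}}(\alpha,Y)$. *)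

(* Defs.v *)
From HB Require Import structures.
From mathcomp Require Import all_boot all_order all_algebra.
From mathcomp Require Import all_classical all_reals all_analysis.
From mathcomp Require Import complex ring lra.

Set Implicit Arguments.
Unset Strict Implicit.
Unset Printing Implicit Defensive.

Import Order.TTheory GRing.Theory Num.Theory.
Import numFieldNormedType.Exports.

Local Open Scope classical_set_scope.
Local Open Scope ring_scope.
Local Open Scope complex_scope.

(* The library norm on row vectors is the sup norm, whence this definition. *)
Definition l2norm (R : realType) (I : finType) (f : I -> R) : R :=
  Num.sqrt (\sum_i f i ^+ 2).

Definition enorm (R : realType) (n : nat) (v : 'rV[R]_n) : R := l2norm (v ord0).

Section l2norm_theory.
Context {R : realType} {I : finType}.
Implicit Types f g : I -> R.

Lemma l2norm_ge0 f : 0 <= l2norm f.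
Proof. exact: sqrtr_ge0. Qed.

Lemma sqr_l2norm f : l2norm f ^+ 2 = \sum_i f i ^+ 2.
Proof. by rewrite sqr_sqrtr// sumr_ge0// => i _; exact: sqr_ge0. Qed.

Lemma l2norm_eq0 f : l2norm f = 0 -> forall i, f i = 0.
Proof.
move=> f0 i; have /eqP := sqr_l2norm f.
rewrite f0 expr0n/= eq_sym psumr_eq0 => [|j _]; last exact: sqr_ge0.
by move=> /allP/(_ i (mem_index_enum i))/=; rewrite sqrf_eq0 => /eqP.
Qed.

Lemma l2norm0 : l2norm (fun _ : I => 0 : R) = 0.
Proof. by rewrite /l2norm big1 ?sqrtr0// => i _; rewrite expr0n. Qed.

Lemma l2norm_le f g : (forall i, 0 <= f i <= g i) -> l2norm f <= l2norm g.
Proof.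
move=> fg; rewrite ler_wsqrtr// ler_sum// => i _.
by have /andP[? ?] := fg i; rewrite lerXn2r// nnegrE (le_trans _ (_ : f i <= _)).
Qed.

Lemma l2norm_cauchy_schwarz f g : \sum_i f i * g i <= l2norm f * l2norm g.
Proof.
have key a b : (a * b) *+ 2 * \sum_i f i * g i <=
    b ^+ 2 * l2norm f ^+ 2 + a ^+ 2 * l2norm g ^+ 2 :> R.
  rewrite !sqr_l2norm !mulr_sumr -big_split/= ler_sum// => i _.
  by rewrite -subr_ge0 [leRHS](_ : _ = (b * f i - a * g i) ^+ 2) ?sqr_ge0//; ring.
have := l2norm_ge0 f; rewrite le_eqVlt => /predU1P[/esym f0|f_gt0].
  by rewrite f0 mul0r big1// => i _; rewrite (l2norm_eq0 f0) mul0r.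
have := l2norm_ge0 g; rewrite le_eqVlt => /predU1P[/esym g0|g_gt0].
  by rewrite g0 mulr0 big1// => i _; rewrite (l2norm_eq0 g0) mulr0.
have ab_gt0 : 0 < (l2norm f * l2norm g) *+ 2 by rewrite pmulrn_lgt0// mulr_gt0.
rewrite -(ler_pM2l ab_gt0); apply: le_trans (key _ _) _.
by rewrite le_eqVlt; apply/orP; left; apply/eqP; ring.
Qed.

Lemma l2norm_triangle f g :
  l2norm (fun i => f i + g i) <= l2norm f + l2norm g.
Proof.
rewrite -(@ler_pXn2r _ 2)// ?nnegrE ?addr_ge0 ?l2norm_ge0// sqr_l2norm.
rewrite sqrrD !sqr_l2norm (eq_bigr (fun i => f i ^+ 2 + (f i * g i) *+ 2 +
  g i ^+ 2)) => [|i _]; last by rewrite sqrrD.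
rewrite !big_split/= lerD2r lerD2l -mulr2n ler_wMn2r//.
exact: l2norm_cauchy_schwarz.
Qed.

End l2norm_theory.

(* The Riemann sphere; [None] is the point at infinity. *)
Definition Cbar (R : realType) : Type := option R[i].

HB.instance Definition _ (R : realType) := Choice.on (Cbar R).

Definition stereographic (R : realType) (x : Cbar R) : 'rV[R]_3 :=
  match x with
  | Some (a +i* b) =>
    let q := a ^+ 2 + b ^+ 2 in
    \row_(j < 3) [:: 2 * a / (q + 1); 2 * b / (q + 1); (q - 1) / (q + 1)]`_j
  | None => \row_(j < 3) [:: 0; 0; 1]`_j
  end.

Definition chordal_dist (R : realType) (x y : Cbar R) : R :=
  enorm (stereographic x - stereographic y).

Section chordal_metric.
Context {R : realType}.
Implicit Types x y : Cbar R.

Lemma stereographic_inj : injective (@stereographic R).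
Proof.
have q1 (a b : R) : a ^+ 2 + b ^+ 2 + 1 != 0.
  by rewrite gt_eqF// ltr_wpDl// addr_ge0 ?sqr_ge0.
have third (p q : R) : p + 1 != 0 -> (p - 1) / (p + 1) = q -> p + 1 = 2 / (1 - q).
  move=> p1 <-; field; rewrite p1/= -?mulrBl.
  by rewrite (_ : p + 1 - (p - 1) = 2) ?pnatr_eq0//; ring.
have third1 (p : R) : p + 1 != 0 -> (p - 1) / (p + 1) <> 1.
  by move=> p1 /(canRL (mulfVK p1)); lra.
move=> [[a b]|] [[c d]|] // /rowP e.
- have := e (Ordinal (isT : (2 < 3)%N)); rewrite !mxE/= => e2.
  have {}e2 : a ^+ 2 + b ^+ 2 + 1 = c ^+ 2 + d ^+ 2 + 1.
    by rewrite (third _ _ (q1 a b) e2) -(third _ _ (q1 c d) erefl).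
  have := e (Ordinal (isT : (0 < 3)%N)); rewrite !mxE/= e2.
  move=> /(mulIf (invr_neq0 (q1 c d)))/mulfI -> ; last by rewrite pnatr_eq0.
  have := e (Ordinal (isT : (1 < 3)%N)); rewrite !mxE/= e2.
  by move=> /(mulIf (invr_neq0 (q1 c d)))/mulfI -> //; rewrite pnatr_eq0.
- by have := e (Ordinal (isT : (2 < 3)%N)); rewrite !mxE/= => /third1 => /(_ (q1 a b)).
- by have := e (Ordinal (isT : (2 < 3)%N)); rewrite !mxE/= => /esym/third1 => /(_ (q1 c d)).
Qed.

Lemma chordal_distxx x : chordal_dist x x = 0.
Proof.
rewrite /chordal_dist subrr /enorm -[RHS](@l2norm0 R 'I_3).
by congr l2norm; apply/funext => i; rewrite mxE.
Qed.

Lemma chordal_dist_eq0 x y : chordal_dist x y = 0 -> x = y.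
Proof.
move=> /l2norm_eq0 xy; apply: stereographic_inj; apply/rowP => i.
by apply/eqP; rewrite -subr_eq0; have := xy i; rewrite !mxE => ->.
Qed.

Lemma chordal_distC x y : chordal_dist x y = chordal_dist y x.
Proof.
rewrite /chordal_dist /enorm /l2norm; congr Num.sqrt.
by apply: eq_bigr => i _; rewrite -sqrrN -opprB !mxE opprK.
Qed.

Lemma chordal_dist_triangle y x z :
  chordal_dist x z <= chordal_dist x y + chordal_dist y z.
Proof.
apply: le_trans (l2norm_triangle _ _); rewrite le_eqVlt; apply/orP; left.
by apply/eqP; congr l2norm; apply/funext => i; rewrite !mxE; ring.
Qed.

End chordal_metric.

HB.instance Definition _ (R : realType) := @isMetric.Build R (Cbar R)
  (@chordal_dist R) chordal_distxx chordal_dist_eq0 chordal_distC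
  chordal_dist_triangle.

(* Finite functions are used rather than plain ones because the latter already
   carry a topology in the library. *)
Definition CbarN (R : realType) (N : nat) : Type := {ffun 'I_N -> Cbar R}.

HB.instance Definition _ (R : realType) (N : nat) := Choice.on (CbarN R N).

Definition CbarN_fun (R : realType) (N : nat) (alpha : CbarN R N) :
  'I_N -> Cbar R := fun_of_fin alpha.

Coercion CbarN_fun : CbarN >-> Funclass.

(* This is the Euclidean distance of the images in R^(3N), the inner [mdist]
   being Euclidean in R^3. *)
Definition CbarN_dist (R : realType) (N : nat) (alpha beta : CbarN R N) : R :=
  l2norm (fun j => mdist (alpha j) (beta j)).

Section CbarN_metric.
Context {R : realType} {N : nat}.
Implicit Types alpha beta : CbarN R N.

Lemma CbarN_distxx alpha : CbarN_dist alpha alpha = 0.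
Proof.
rewrite -[RHS](@l2norm0 R 'I_N); congr l2norm.
by apply/funext => j; exact: mdistxx.
Qed.

Lemma CbarN_dist_eq0 alpha beta : CbarN_dist alpha beta = 0 -> alpha = beta.
Proof.
by move=> /l2norm_eq0 ab; apply/ffunP => j; apply: mdist_positivity (ab j).
Qed.

Lemma CbarN_distC alpha beta : CbarN_dist alpha beta = CbarN_dist beta alpha.
Proof. by congr l2norm; apply/funext => j; exact: metric_sym. Qed.

Lemma CbarN_dist_triangle beta alpha gamma :
  CbarN_dist alpha gamma <= CbarN_dist alpha beta + CbarN_dist beta gamma.
Proof.
apply: le_trans (l2norm_triangle _ _); apply: l2norm_le => j.
by rewrite mdist_ge0 metric_triangle.
Qed.

End CbarN_metric.

HB.instance Definition _ (R : realType) (N : nat) :=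
  @isMetric.Build R (CbarN R N) (@CbarN_dist R N)
  CbarN_distxx CbarN_dist_eq0 CbarN_distC CbarN_dist_triangle.

Definition cexp (R : realType) (w : R[i]) : R[i] :=
  (expR (complex.Re w))%:C * (cos (complex.Im w) +i* sin (complex.Im w)).

Definition green (R : realType) (z : R[i]) (x : 'rV[R]_3) : R[i] :=
  cexp ('i%C * z * (enorm x)%:C) / (4 * pi * enorm x)%:C.

Definition Gamma (R : realType) (n : nat) (alpha : 'I_n -> R[i])
    (Y : 'I_n -> 'rV[R]_3) (z : R[i]) : 'M[R[i]]_n :=
  \matrix_(j, j') if j == j' then alpha j - 'i%C * z / (4 * pi)%:C
                  else - green z (Y j - Y j').

Definition finite_idx (R : realType) (N : nat) (alpha : CbarN R N) : {set 'I_N} :=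
  [set j | alpha j != None]%SET.

(* The default value 0 below is never used: [enum_val i] is in [finite_idx]. *)
Definition detGamma (R : realType) (N : nat) (alpha : CbarN R N)
    (Y : 'I_N -> 'rV[R]_3) (z : R[i]) : R[i] :=
  let alpha' (i : 'I_#|finite_idx alpha|) := odflt 0 (alpha (enum_val i)) in
  let Y' (i : 'I_#|finite_idx alpha|) := Y (enum_val i) in
  \det (Gamma alpha' Y' z).

Definition Sigma (R : realType) (N : nat) (alpha : CbarN R N)
    (Y : 'I_N -> 'rV[R]_3) : set R[i] :=
  [set z | detGamma alpha Y z = 0].

Definition Sigma_res (R : realType) (N : nat) (alpha : CbarN R N)
    (Y : 'I_N -> 'rV[R]_3) : set R[i] :=
  Sigma alpha Y `&` ([set z | complex.Im z < 0] `|` [set z | complex.Im z = 0]).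

(* In the remaining definitions the family {H_alpha : alpha in S} is given by
   its parameter set S. *)
Definition Sigma_family (R : realType) (N : nat) (S : set (CbarN R N))
    (Y : 'I_N -> 'rV[R]_3) : set R[i] :=
  \bigcup_(alpha in S) Sigma alpha Y.

Definition Sigma_res_family (R : realType) (N : nat) (S : set (CbarN R N))
    (Y : 'I_N -> 'rV[R]_3) : set R[i] :=
  \bigcup_(alpha in S) Sigma_res alpha Y.

Definition achievable (R : realType) (N : nat) (S : set (CbarN R N))
    (Y : 'I_N -> 'rV[R]_3) (f : R) : Prop :=
  exists2 k, Sigma_res_family S Y k & f = complex.Re k.

Definition r_min (R : realType) (N : nat) (S : set (CbarN R N))
    (Y : 'I_N -> 'rV[R]_3) (f : R) : R :=
  inf [set r | 0 <= r /\ Sigma_res_family S Y (f -i* r)].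

Definition minimal_decay (R : realType) (N : nat) (S : set (CbarN R N))
    (Y : 'I_N -> 'rV[R]_3) (f : R) (alpha : CbarN R N) : Prop :=
  Sigma_res alpha Y (f -i* r_min S Y f).

(* Main.v *)
From HB Require Import structures.
Require Import Defs.
From mathcomp Require Import all_boot all_order all_algebra.
From mathcomp Require Import all_classical all_reals all_analysis.
From mathcomp Require Import complex ring lra.
Import Order.TTheory GRing.Theory Num.Theory.
Import numFieldNormedType.Exports.
Local Open Scope classical_set_scope.
Local Open Scope ring_scope.

(** The family [alpha] ranges over a closed, hence compact, set of parameters,
and the relation [z \in Sigma alpha Y] is closed in the pair [(alpha, z)];
projecting a closed relation along a compact factor gives a closed set, so
[Sigma_family S Y] is closed.  Minimal decay then follows: the decay rates
[r >= 0] for which [f - ir] is a resonance form a nonempty closed set bounded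
below, which contains its infimum.

The delicate point is that the relation is closed at [alpha_j = oo], where
the size of the matrix [Gamma] drops.  Write [alpha_j = a_j / b_j] with
[(a_j, b_j)] in the unit sphere of [C^2], and multiply the [j]-th row of
[Gamma] by [b_j].  The resulting matrix [homGamma] has diagonal entries
[a_j - b_j iz / 4 pi] and off-diagonal entries [- b_j G_z], so it always has
size [N] and its determinant is jointly continuous in [(a, b, z)]
([continuous_det_homGamma]).  When [b_j = 0] its [j]-th row is [a_j] times a
unit vector with [a_j != 0], so this determinant vanishes exactly when the
minor deleting all such rows and columns does; that minor is, up to the
nonzero factors [b_j], the determinant of the reduced [Gamma]
([detGamma_eq0]).

It remains to lift [S] to the product of [N] copies of the 3-sphere, compact by
Tychonoff ([compact_spheres]).  The ratio map from the 3-sphere onto the Riemann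
sphere, read through stereographic projection, is the Hopf map
([stereographic_hratio]).  Being polynomial, it is continuous for the chordal
metric, including at infinity ([ratios_continuous_within]). *)

Set Implicit Arguments.
Unset Strict Implicit.
Unset Printing Implicit Defensive.

(** * Infima of closed sets *)

Lemma closed_inf (R : realType) (A : set R) :
  closed A -> A !=set0 -> has_lbound A -> A (inf A).
Proof.
move=> clA A0 lbA; apply: clA => B /nbhs_ballP[e /= e0 eB].
have [x Ax xlt] := inf_adherent e0 (conj A0 lbA).
exists x; split=> //; apply: eB.
by rewrite /ball/= distrC ger0_norm ?subr_ge0 ?ge_inf// ltrBlDl.
Qed.

(** * Continuity of determinants and of complex-valued functions *)

Lemma continuous_det (K : numFieldType) (T : topologicalType) (n : nat)
    (A : T -> 'M[K]_n) :
  (forall i j, continuous (fun t => A t i j)) -> continuous (fun t => \det (A t)).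
Proof.
move=> cA; apply: continuous_big => [|s _ t]; first exact: add_continuous.
apply: cvgM; first exact: cvg_cst.
by apply: continuous_big => [|i _]; [exact: mul_continuous|exact: cA].
Qed.

Lemma complex_continuousD (R : realType) (T : topologicalType) (f g : T -> R[i]^o) :
  continuous f -> continuous g -> continuous (fun t => f t + g t : R[i]^o).
Proof. by move=> cf cg t; apply: (@cvgD _ (R[i]^o)); [exact: cf|exact: cg]. Qed.

Lemma complex_continuousM (R : realType) (T : topologicalType) (f g : T -> R[i]^o) :
  continuous f -> continuous g -> continuous (fun t => f t * g t : R[i]^o).
Proof. by move=> cf cg t; apply: (@cvgM R[i]); [exact: cf|exact: cg]. Qed.

Lemma complex_continuousN (R : realType) (T : topologicalType) (f : T -> R[i]^o) :
  continuous f -> continuous (fun t => - f t : R[i]^o).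
Proof. by move=> cf t; apply: (@cvgN _ (R[i]^o)); exact: cf. Qed.

Lemma continuous_Re (R : realType) : continuous (fun z : R[i]^o => complex.Re z).
Proof.
move=> z; apply/(@cvgrPdist_lt _ R _ _ (nbhs_filter (z : R[i]^o))) => e e0.
have eC : 0 < real_complex _ e by rewrite ltcR.
have := @cvgr_dist_lt _ (R[i]^o) _ _ (nbhs_filter (z : R[i]^o)) id z cvg_id _ eC.
apply: filterS => w zw; rewrite -ltcR; apply: le_lt_trans zw.
by rewrite -raddfB; exact: normc_ge_Re.
Qed.

Lemma continuous_Im (R : realType) : continuous (fun z : R[i]^o => complex.Im z).
Proof.
move=> z.
rewrite (_ : (fun z => _) = (fun w : R[i]^o => complex.Re w) \o
  (fun w : R[i]^o => - 'i%C * w : R[i]^o)); last first.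
  by apply/funext => -[a b] /=; ring.
apply: (@continuous_comp (R[i]^o) (R[i]^o) R); last exact: (@continuous_Re R).
exact: (@mulrl_continuous R[i]).
Qed.

Lemma continuous_real_complex (R : realType) (T : topologicalType) (g : T -> R) :
  continuous g -> continuous (fun t => (g t)%:C%C : R[i]^o).
Proof.
move=> cg t; apply/(@cvgrPdist_lt _ (R[i]^o)) => -[e e'].
rewrite ltcE/= => /andP[/eqP -> e0]; near=> w.
rewrite -rmorphB normc_def/= expr0n/= addr0 sqrtr_sqr ltcR.
by near: w; apply: cvgr_dist_lt => //; exact: cg.
Unshelve. all: by end_near. Qed.

Lemma continuous_complex (R : realType) (T : topologicalType) (g h : T -> R) :
  continuous g -> continuous h -> continuous (fun t => (g t +i* h t)%C : R[i]^o).
Proof.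
move=> cg ch t; rewrite (_ : (fun t => _) =
  (fun t => (g t)%:C%C + 'i%C * (h t)%:C%C : R[i]^o)); last first.
  by apply/funext => x; rewrite [LHS]complexE.
apply: (@cvgD _ (R[i]^o)); first exact: continuous_real_complex.
by apply: (@cvgM R[i]); [exact: cvg_cst|exact: continuous_real_complex].
Qed.

Lemma continuous_cexp (R : realType) : continuous (fun z : R[i]^o => cexp z : R[i]^o).
Proof.
have cRe := @continuous_Re R; have cIm := @continuous_Im R.
have cexpRe : continuous (fun z : R[i]^o => expR (complex.Re z)).
  by move=> z; apply: (continuous_comp (@cRe z)); exact: continuous_expR.
have ccosIm : continuous (fun z : R[i]^o => cos (complex.Im z)).
  by move=> z; apply: (continuous_comp (@cIm z)); exact: continuous_cos.
have csinIm : continuous (fun z : R[i]^o => sin (complex.Im z)).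
  by move=> z; apply: (continuous_comp (@cIm z)); exact: continuous_sin.
exact: (complex_continuousM (continuous_real_complex cexpRe)
  (continuous_complex ccosIm csinIm)).
Qed.

(** * Matrices with diagonal rows *)

(** A vector killed by [M] must vanish outside [A], because there the equation
of row [j] reads [M j j * v j = 0].  The kernel of [M] is thus the kernel of the
principal submatrix on [A], extended by zero. *)
Lemma det_eq0_principal (F : fieldType) (n : nat) (A : {set 'I_n}) (M : 'M[F]_n) :
    (forall j, j \notin A -> M j j != 0) ->
    (forall j k, j \notin A -> k != j -> M j k = 0) ->
  (\det M == 0) = (\det (mxsub (fun i : 'I_#|A| => enum_val i)
    (fun i : 'I_#|A| => enum_val i) M) == 0).
Proof.
move=> Mjj Mjk.
(* [det0P] speaks of left kernels, while the rows of [M] are the equations. *)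
rewrite -det_tr -[in RHS]det_tr; set B := mxsub _ _ M.
have sumA (v : 'rV_n) (j : 'I_n) : (forall k, k \notin A -> v ord0 k = 0) ->
    (v *m M^T) ord0 j = \sum_(i < #|A|) v ord0 (enum_val i) * M j (enum_val i).
  move=> vA; rewrite mxE (bigID (mem A))/= [X in _ + X]big1 ?addr0 => [|k kA]; last first.
    by rewrite vA// mul0r.
  by rewrite big_enum_val/=; apply: eq_bigr => i _; rewrite mxE.
apply/det0P/det0P => -[v v0 vM].
- have vA k : k \notin A -> v ord0 k = 0.
    move=> kA; have /rowP/(_ k) := vM; rewrite !mxE (bigD1 k)//= big1 ?addr0 => [|i ik].
      by rewrite mxE => /eqP; rewrite mulf_eq0 (negPf (Mjj k kA)) orbF => /eqP.
    by rewrite mxE Mjk// mulr0.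
  exists (\row_i v ord0 (enum_val i)); last first.
    apply/rowP => i; have /rowP/(_ (enum_val i)) := vM; rewrite sumA// !mxE => vi; rewrite -[RHS]vi.
    by apply: eq_bigr => k _; rewrite !mxE.
  apply: contra v0 => /eqP/rowP v0; apply/eqP/rowP => k; rewrite mxE.
  have [kA|/vA//] := boolP (k \in A).
  by have := v0 (enum_rank_in kA k); rewrite !mxE enum_rankK_in.
- (* [v] extended by zero outside [A]. *)
  pose w : 'rV[F]_n := \row_k \sum_i v ord0 i * (enum_val i == k)%:R.
  have wE i : w ord0 (enum_val i) = v ord0 i.
    rewrite mxE (bigD1 i)//= eqxx mulr1 big1 ?addr0// => k ki.
    by rewrite (inj_eq enum_val_inj) (negPf ki) mulr0.
  have wA k : k \notin A -> w ord0 k = 0.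
    move=> kA; rewrite mxE big1// => i _; case: eqP => [ik|]; last by rewrite mulr0.
    by move: kA; rewrite -ik (enum_valP i).
  exists w.
    apply: contra v0 => /eqP w0; apply/eqP/rowP => i; by rewrite -wE w0 !mxE.
  apply/rowP => j; rewrite sumA// mxE; have [jA|jA] := boolP (j \in A).
    have /rowP/(_ (enum_rank_in jA j)) := vM; rewrite !mxE => vj; rewrite -[RHS]vj.
    by apply: eq_bigr => i _; rewrite wE !mxE enum_rankK_in.
  rewrite big1// => i _; rewrite Mjk ?mulr0//.
  by apply: contraNneq jA => <-; exact: (enum_valP i).
Qed.

(** * Homogeneous coordinates on the Riemann sphere *)

Definition sphere3 (R : realType) : set ((R * R) * (R * R)) :=
  [set v | v.1.1 ^+ 2 + v.1.2 ^+ 2 + v.2.1 ^+ 2 + v.2.2 ^+ 2 = 1].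

(** A point [((a, b), (c, d))] stands for the pair of homogeneous coordinates
[(a + ib, c + id)]. *)
Definition hnum (R : realType) (v : (R * R) * (R * R)) : R[i] := (v.1.1 +i* v.1.2)%C.

Definition hden (R : realType) (v : (R * R) * (R * R)) : R[i] := (v.2.1 +i* v.2.2)%C.

Definition hratio (R : realType) (v : (R * R) * (R * R)) : Cbar R :=
  if hden v == 0 then None else Some (hnum v / hden v).

(** The Hopf map from the 3-sphere to the 2-sphere. *)
Definition hopf (R : realType) (v : (R * R) * (R * R)) (j : 'I_3) : R :=
  [:: 2 * (v.1.1 * v.2.1 + v.1.2 * v.2.2); 2 * (v.1.2 * v.2.1 - v.1.1 * v.2.2);
      v.1.1 ^+ 2 + v.1.2 ^+ 2 - v.2.1 ^+ 2 - v.2.2 ^+ 2]`_j.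

(** On the unit sphere the denominators in the stereographic projection cancel,
leaving the quadratic polynomials of the Hopf map.  These make no distinction
between finite points and infinity, which is where the continuity of [hratio]
at a vanishing denominator comes from. *)
Lemma stereographic_hratio (R : realType) (v : (R * R) * (R * R)) :
  sphere3 v -> stereographic (hratio v) = \row_j hopf v j.
Proof.
case: v => [[a b] [c d]]; rewrite /sphere3/= => abcd.
have cpx0 : (c +i* d)%C == 0 :> R[i] = (c == 0) && (d == 0) by rewrite eq_complex.
rewrite /hratio/= /hden/= cpx0; apply/rowP => j; rewrite [RHS]mxE /hopf /=.
case: ifPn => [/andP[/eqP c0 /eqP d0]|cd0].
  rewrite mxE c0 d0 !mulr0 !addr0 subr0 !mulr0 expr0n/= !subr0.
  by rewrite (_ : a ^+ 2 + b ^+ 2 = 1)// -abcd c0 d0 expr0n/= !addr0.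
have D0 : c ^+ 2 + d ^+ 2 != 0.
  by rewrite paddr_eq0 ?sqr_ge0// !sqrf_eq0.
have D1 : a ^+ 2 + b ^+ 2 = 1 - (c ^+ 2 + d ^+ 2) by lra.
pose D := c ^+ 2 + d ^+ 2.
have -> : (hnum (a, b, (c, d)) / (c +i* d)%C)%C =
    ((a * c + b * d) / D +i* ((b * c - a * d) / D))%C :> R[i].
  by rewrite /hnum/=; simpc; congr Complex; rewrite /D; field; exact: D0.
rewrite mxE.
have -> : ((a * c + b * d) / D) ^+ 2 + ((b * c - a * d) / D) ^+ 2 = D^-1 - 1.
  transitivity ((a ^+ 2 + b ^+ 2) / D); first by rewrite /D; field; exact: D0.
  by rewrite D1 mulrBl mul1r divff.
rewrite subrK invrK; case: j => -[|[|[|//]]] /= _.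
- by rewrite -!mulrA mulVf ?mulr1.
- by rewrite -!mulrA mulVf ?mulr1.
- by rewrite !mulrBl mulVf// D1 /D; ring.
Qed.

Lemma hratio_surj (R : realType) (x : Cbar R) : exists2 v, sphere3 v & hratio v = x.
Proof.
case: x => [[a b]|]; last first.
  exists (1, 0, (0, 0)); first by rewrite /sphere3/=; ring.
  by rewrite /hratio /hden /= eqxx.
pose s := Num.sqrt (a ^+ 2 + b ^+ 2 + 1).
have q0 : 0 < a ^+ 2 + b ^+ 2 + 1 by rewrite ltr_wpDl// addr_ge0 ?sqr_ge0.
have s0 : s != 0 by rewrite gt_eqF// sqrtr_gt0.
have s2 : s ^+ 2 = a ^+ 2 + b ^+ 2 + 1 by rewrite sqr_sqrtr// ltW.
(* The pair [(a + ib, 1)] normalized to unit length. *)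
exists (a / s, b / s, (s^-1, 0)).
  by rewrite /sphere3/= !expr_div_n exprVn s2; field; exact: lt0r_neq0.
rewrite /hratio /hden /hnum /= eq_complex /= invr_eq0 (negPf s0)/=; congr Some.
by simpc; congr Complex; field.
Qed.

Lemma sphere3_neq0 (R : realType) (v : (R * R) * (R * R)) :
  sphere3 v -> hden v = 0 -> hnum v != 0.
Proof.
case: v => [[a b] [c d]]; rewrite /sphere3/hden/hnum/= => abcd [c0 d0].
apply/eqP => -[a0 b0]; move: abcd; rewrite a0 b0 c0 d0 expr0n/= !addr0 => /eqP.
by rewrite eq_sym oner_eq0.
Qed.

Section coordinates.
Context {R : realType} {T : topologicalType} (v : T -> (R * R) * (R * R)).
Hypothesis cv : continuous v.

Lemma continuous_v11 : continuous (fun t => (v t).1.1).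
Proof. by move=> t; apply: (cvg_comp _ _ (cvg_comp _ _ (@cv t) cvg_fst) cvg_fst). Qed.
Lemma continuous_v12 : continuous (fun t => (v t).1.2).
Proof. by move=> t; apply: (cvg_comp _ _ (cvg_comp _ _ (@cv t) cvg_fst) cvg_snd). Qed.
Lemma continuous_v21 : continuous (fun t => (v t).2.1).
Proof. by move=> t; apply: (cvg_comp _ _ (cvg_comp _ _ (@cv t) cvg_snd) cvg_fst). Qed.
Lemma continuous_v22 : continuous (fun t => (v t).2.2).
Proof. by move=> t; apply: (cvg_comp _ _ (cvg_comp _ _ (@cv t) cvg_snd) cvg_snd). Qed.

Lemma continuous_hnum : continuous (fun t => hnum (v t) : R[i]^o).
Proof. exact: (continuous_complex continuous_v11 continuous_v12). Qed.

Lemma continuous_hden : continuous (fun t => hden (v t) : R[i]^o).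
Proof. exact: (continuous_complex continuous_v21 continuous_v22). Qed.

Lemma continuous_hopf j : continuous (fun t => hopf (v t) j).
Proof.
have c11 := continuous_v11; have c12 := continuous_v12.
have c21 := continuous_v21; have c22 := continuous_v22.
case: j => -[|[|[|j]]] //= ? t; rewrite /hopf /=.
- apply: cvgM; first exact: cvg_cst.
  by apply: cvgD; apply: cvgM; [exact: c11|exact: c21|exact: c12|exact: c22].
- apply: cvgM; first exact: cvg_cst.
  by apply: cvgB; apply: cvgM; [exact: c12|exact: c21|exact: c11|exact: c22].
- by apply: cvgB; [apply: cvgB; [apply: cvgD|]|]; apply: cvgM;
    (exact: c11 || exact: c12 || exact: c21 || exact: c22).
Qed.
End coordinates.

Lemma compact_sphere3 (R : realType) : compact (@sphere3 R).
Proof.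
pose I : set R := [set` `[-1, 1]].
have cI : compact ((I `*` I) `*` (I `*` I)).
  by do 2!apply: compact_setX; exact: segment_compact.
apply: subclosed_compact cI _.
  have id_cont : continuous (@id ((R * R) * (R * R))) by move=> x; exact: cvg_id.
  have c11 := continuous_v11 id_cont; have c12 := continuous_v12 id_cont.
  have c21 := continuous_v21 id_cont; have c22 := continuous_v22 id_cont.
  have cq : continuous (fun v : (R * R) * (R * R) =>
      v.1.1 ^+ 2 + v.1.2 ^+ 2 + v.2.1 ^+ 2 + v.2.2 ^+ 2).
    by move=> t; apply: cvgD; [apply: cvgD; [apply: cvgD|]|]; apply: cvgM;
      (exact: c11 || exact: c12 || exact: c21 || exact: c22).
  exact: (proj1 (continuous_closedP _) cq _ (@closed_eq R 1)).
move=> [[a b] [c d]]; rewrite /sphere3 /I /= !in_itv /= => abcd.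
have itvP (x : R) : x ^+ 2 <= 1 -> -1 <= x <= 1.
  by move=> x1; apply/andP; split; nra.
have sq0 (x : R) : 0 <= x ^+ 2 by exact: sqr_ge0.
have := sq0 a; have := sq0 b; have := sq0 c; have := sq0 d => d0 c0 b0 a0.
by split; split; apply: itvP; lra.
Qed.

(** * Homogeneous coordinates for tuples *)

(** A copy of the function type that carries the product topology, to which
Tychonoff's theorem applies. *)
Definition hcoords (R : realType) (N : nat) : Type :=
  {ptws 'I_N -> ((R * R) * (R * R))%type}.

HB.instance Definition _ (R : realType) (N : nat) :=
  Topological.copy (hcoords R N) {ptws 'I_N -> ((R * R) * (R * R))%type}.

Definition spheres (R : realType) (N : nat) : set (hcoords R N) :=
  [set u | forall j, sphere3 (u j)].

Definition ratios (R : realType) (N : nat) (u : hcoords R N) : CbarN R N :=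
  [ffun j => hratio (u j)].

Lemma continuous_coord (R : realType) (N : nat) (j : 'I_N) :
  continuous (fun u : hcoords R N => u j).
Proof. exact: (@proj_continuous _ (fun=> ((R * R) * (R * R))%type) j). Qed.

Lemma compact_spheres (R : realType) (N : nat) : compact (@spheres R N).
Proof.
exact: (@tychonoff _ (fun=> ((R * R) * (R * R))%type) _
  (fun j : 'I_N => @compact_sphere3 R)).
Qed.

Lemma ratios_surj (R : realType) (N : nat) (alpha : CbarN R N) :
  exists2 u, spheres u & ratios u = alpha.
Proof.
have /boolp.choice[u uP] : forall j, exists v, sphere3 v /\ hratio v = alpha j.
  by move=> j; have [v ? ?] := hratio_surj (alpha j); exists v.
exists u => [j|]; first by have [] := uP j.
by apply/ffunP => j; rewrite ffunE; have [] := uP j.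
Qed.

Lemma continuous_l2norm (R : realType) (T : topologicalType) (I : finType)
    (f : I -> T -> R) :
  (forall i, continuous (f i)) -> continuous (fun t => l2norm (f^~ t)).
Proof.
move=> cf t.
have csum : continuous (fun t => \sum_i f i t ^+ 2).
  apply: continuous_big => [|i _ x]; first exact: add_continuous.
  exact: (cvgM (cf i x) (cf i x)).
exact: (continuous_comp (csum t) (@sqrt_continuous R _)).
Qed.

Lemma mdist_ratios (R : realType) (N : nat) (u v : hcoords R N) :
  spheres u -> spheres v ->
  mdist (ratios u) (ratios v) =
  l2norm (fun j => l2norm (fun i => hopf (u j) i - hopf (v j) i)).
Proof.
move=> uS vS; congr l2norm; apply/funext => j; congr l2norm; apply/funext => i.
by rewrite /ratios /CbarN_fun !ffunE !stereographic_hratio ?mxE.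
Qed.

(** The distance between two images is a continuous function of the Hopf
coordinates that vanishes when the two points coincide. *)
Lemma ratios_continuous_within (R : realType) (N : nat) :
  {within @spheres R N, continuous (@ratios R N)}.
Proof.
apply/subspace_continuousP => u uS; apply/cvg_ballP => e e0.
pose d (v : hcoords R N) :=
  l2norm (fun j => l2norm (fun i => hopf (u j) i - hopf (v j) i)).
have cd : continuous d.
  apply: continuous_l2norm => j; apply: continuous_l2norm => i v.
  exact: (cvgB (cvg_cst _) (@continuous_hopf _ _ _ (@continuous_coord R N j) i v)).
have du : d u < e by rewrite /d -mdist_ratios// mdistxx.
rewrite near_withinE; near=> v => vS.
rewrite ballEmdist/= mdist_ratios//; near: v.
exact: (cvgr_lt _ (cd u)).
Unshelve. all: by end_near. Qed.

(** * The homogenized determinant *)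

(** Each row of [Gamma] multiplied by the denominator of its parameter: this
removes the pole at infinity and keeps the size of the matrix constant. *)
Definition homGamma (R : realType) (N : nat) (u : hcoords R N)
    (Y : 'I_N -> 'rV[R]_3) (z : R[i]) : 'M[R[i]]_N :=
  \matrix_(j, j') if j == j'
    then hnum (u j) - hden (u j) * ('i%C * z / (4 * pi)%:C%C)
    else - (hden (u j) * green z (Y j - Y j')).

(** The rows with [hden (u j) = 0] are diagonal, with nonzero entry [hnum (u j)],
and the principal submatrix on the other indices is the reduced [Gamma] with its
rows scaled by the nonzero [hden (u j)]. *)
Lemma detGamma_eq0 (R : realType) (N : nat) (u : hcoords R N)
    (Y : 'I_N -> 'rV[R]_3) (z : R[i]) : spheres u ->
  (\det (homGamma u Y z) == 0) = (detGamma (ratios u) Y z == 0).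
Proof.
move=> uS; pose A := finite_idx (ratios u).
have inA j : (j \in A) = (hden (u j) != 0).
  by rewrite inE /ratios /CbarN_fun ffunE /hratio; case: ifP.
rewrite (@det_eq0_principal _ _ A) => [|j|j k].
- rewrite /detGamma; set G := Gamma _ _ z.
  rewrite (_ : mxsub _ _ _ = diag_mx (\row_i hden (u (enum_val i))) *m G).
    rewrite det_mulmx mulf_eq0 det_diag; case: eqP => //= /eqP.
    rewrite prodf_seq_eq0 => /hasP[i _ /=]; rewrite mxE.
    by rewrite -[_ == 0]negbK -inA enum_valP.
  apply/matrixP => i k; rewrite mul_diag_mx !mxE (inj_eq enum_val_inj).
  case: eqP => _; last by rewrite mulrN.
  rewrite mulrBr; congr (_ - _).
  have := enum_valP i; rewrite inA => ni.
  by rewrite /ratios /CbarN_fun ffunE /hratio (negPf ni)/= mulrC mulfVK.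
- rewrite inA negbK mxE eqxx => /eqP d0; rewrite d0 mul0r subr0.
  exact: sphere3_neq0.
- rewrite inA negbK mxE [j == k]eq_sym => /eqP d0 /negPf ->.
  by rewrite d0 mul0r oppr0.
Qed.

Lemma continuous_green (R : realType) (x : 'rV[R]_3) :
  continuous (fun z : R[i]^o => green z x : R[i]^o).
Proof.
have cst (c : R[i]) : continuous (fun _ : R[i]^o => c : R[i]^o) by exact: cst_continuous.
apply: complex_continuousM (cst _) => z.
apply: (@continuous_comp (R[i]^o) (R[i]^o) (R[i]^o)); last exact: continuous_cexp.
apply: (complex_continuousM (complex_continuousM (cst 'i%C) _) (cst _)).
by move=> w; exact: cvg_id.
Qed.

Lemma continuous_det_homGamma (R : realType) (N : nat) (Y : 'I_N -> 'rV[R]_3) :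
  continuous (fun p : hcoords R N * R[i]^o => \det (homGamma p.1 Y p.2) : R[i]^o).
Proof.
apply: (@continuous_det R[i] _ N
  (fun p : hcoords R N * R[i]^o => homGamma p.1 Y p.2)) => j k.
have cu : continuous (fun p : hcoords R N * R[i]^o => p.1 j).
  move=> p; apply: (@continuous_comp _ (hcoords R N) _ fst (fun u => u j)).
    exact: cvg_fst.
  exact: continuous_coord.
have cz : continuous (fun p : hcoords R N * R[i]^o => p.2) by move=> p; exact: cvg_snd.
have cst (c : R[i]) : continuous (fun _ : hcoords R N * R[i]^o => c : R[i]^o).
  by exact: cst_continuous.
have cn := continuous_hnum cu; have cd := continuous_hden cu.
under eq_fun do rewrite mxE.
case: (j == k).
  apply: (complex_continuousD cn (complex_continuousN (complex_continuousM cd _))).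
  exact: (complex_continuousM (complex_continuousM (cst _) cz) (cst _)).
have cg : continuous (fun p : hcoords R N * R[i]^o => green p.2 (Y j - Y k) : R[i]^o).
  by move=> p; exact: (continuous_comp (cz p) (@continuous_green R (Y j - Y k) p.2)).
exact: (complex_continuousN (complex_continuousM cd cg)).
Qed.

(** * Closedness of the spectrum of the family *)

(** Given [z] outside the set, each point [u] of the compact product of spheres
has a neighbourhood on which, for all [w] near [z], [w] is not produced by a
member of [S]: by continuity of the determinant if [ratios u] lies in [S], and
because the complement of [S] is open otherwise.  Compactness makes the
neighbourhood of [z] uniform in [u]. *)
Lemma closed_Sigma_family (R : realType) (N : nat) (Y : 'I_N -> 'rV[R]_3)
    (S : set (CbarN R N)) :
  closed S -> closed (Sigma_family S Y : set R[i]^o).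
Proof.
move=> clS; rewrite -openC openE => z zN; rewrite /interior.
pose P (w : R[i]^o) (u : hcoords R N) := S (ratios u) -> \det (homGamma u Y w) != 0.
have /compact_near_coveringP/near_covering_withinP := @compact_spheres R N.
move=> /(_ _ (nbhs (z : R[i]^o)) P _) cov.
have covP : \forall w \near (z : R[i]^o), @spheres R N `<=` P w.
  apply: cov => u uS; have [uSS|uNS] := pselect (S (ratios u)).
    have det0 : \det (homGamma u Y z) != 0.
      by rewrite detGamma_eq0//; apply/eqP => d0; apply: zN; exists (ratios u).
    have := @cvgr_neq0 _ (R[i]^o) _ _ (nbhs_filter _) _ _
      (@continuous_det_homGamma R N Y (u, z)) det0.
    by apply: filterS => -[v w] /= vw0 _ _.
  have /subspace_continuousP/(_ _ uS)/(_ (~` S)) := @ratios_continuous_within R N.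
  have nS : nbhs (ratios u) (~` S).
    by apply: open_nbhs_nbhs; split=> //; rewrite openC.
  move=> /(_ nS) /(@cvg_fst _ _ (nbhs u) (nbhs (z : R[i]^o))) vS.
  by apply: (@filterS _ (filter_prod (nbhs u) (nbhs (z : R[i]^o))) _ _ _ _ vS) =>
    -[v w] /= vNS vK /(vNS vK).
apply: filterS covP => w wP [alpha alphaS]; have [u uS ua] := ratios_surj alpha.
rewrite /Sigma/= -ua => /eqP; rewrite -detGamma_eq0//; apply/negP/wP => //.
by rewrite ua.
Qed.

(** * Resonances and minimal decay *)

Lemma Sigma_res_familyE (R : realType) (N : nat) (S : set (CbarN R N))
    (Y : 'I_N -> 'rV[R]_3) (z : R[i]) :
  Sigma_res_family S Y z <-> Sigma_family S Y z /\ complex.Im z <= 0.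
Proof.
rewrite le_eqVlt; split=> [[alpha Sa [za zi]]|[[alpha Sa za] zi]].
  by split; [exists alpha|case: zi => ->; rewrite ?eqxx ?orbT].
exists alpha => //; split => //.
by case/predU1P: zi; [right|left].
Qed.

(* [R[i]^o] is [R[i]] with the topology of its modulus. *)
Theorem theorem4p1 (R : realType) (N : nat) (Y : 'I_N -> 'rV[R]_3)
    (Y_distinct : injective Y) (S : set (CbarN R N)) (S_closed : closed S) :
  closed (Sigma_family S Y : set R[i]^o) /\
  forall f : R, achievable S Y f ->
    exists2 alpha, S alpha & minimal_decay S Y f alpha.
Proof.
have clSigma := closed_Sigma_family (Y := Y) S_closed.
split=> // f [[g h] /Sigma_res_familyE[/= ghS h0] /= fg]; rewrite -{g}fg in ghS.
(* By definition [r_min S Y f] is the infimum of this set. *)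
pose A := [set r | 0 <= r /\ Sigma_res_family S Y (f -i* r)%C].
have AE : A = [set r | 0 <= r] `&`
    (fun r => (f -i* r)%C : R[i]^o) @^-1` Sigma_family S Y.
  apply/seteqP; split=> r.
    by move=> [r0 /Sigma_res_familyE[]].
  by move=> [r0 Sr]; split=> //; apply/Sigma_res_familyE; split; rewrite //= oppr_le0.
have clA : closed A.
  rewrite AE; apply: closedI; first exact: closed_ge.
  have cr : continuous (fun r : R => (f -i* r)%C : R[i]^o).
    apply: continuous_complex => r; first exact: cvg_cst.
    by apply: cvgN; exact: cvg_id.
  exact: (proj1 (continuous_closedP _) cr _ clSigma).
have [] : A (inf A).
  apply: closed_inf => //; first by exists (- h); rewrite AE /= opprK oppr_ge0.
  by exists 0 => r [].
by move=> _ [alpha Sa ?]; exists alpha.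
Qed.
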